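(* Suppose the random walk on $X$ induced by $\mu$ is uniquely ergodic and locally uniformly recurrent on average. Then for every $f\in C_c(X)$, every compact $K\subset X$ and every $\epsilon>0$ there exists $n_0\in\mathbb{N}$ such that for all $n\ge n_0$ and $x\in K$, $$\Big|\frac1n\sum_{k=0}^{n-1}\int_X f\,d(\mu^{*k}*\delta_x)-\int_X f\,dm_X\Big|<\epsilon.$$ Equivalently, the maps $x\mapsto\frac1n\sum_{k=0}^{n-1}\mu^{*k}*\delta_x$ (into probability measures with the weak* topology) converge to $m_X$ uniformly on compact subsets of $X$.
   Context: Standing assumptions: $G$ is a locally compact $\sigma$-compact metrizable group acting ergodically on a locally compact $\sigma$-compact metrizable space $X$ with a $G$-invariant probability measure $m_X$; $\mu$ is a Borel probability measure on $G$. $\mu^{*n}*\delta_x$ is the push-forward of $\mu^{\otimes n}\otimes\delta_x$ under $(g_n,\dots,g_1,x)\mapsto g_n\cdots g_1x$. A probability measure $\nu$ on $X$ is $\mu$-stationary if $\mu*\nu=\nu$; the random walk is uniquely ergodic if $m_X$ is the unique $\mu$-stationary probability measure on $X$. The random walk is locally uniformly recurrent on average if for every compact $K\subset X$ and $\epsilon>0$ there are $n_0$ and a compact $M\subset X$ with $\frac1n\sum_{k=0}^{n-1}\mu^{*k}*\delta_x(M)\ge1-\epsilon$ for all $n\ge n_0$, $x\in K$. *)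

(* Defs.v *)
From HB Require Import structures.
From mathcomp Require Import all_boot all_order all_algebra.
From mathcomp Require Import all_classical all_reals all_analysis.
Set Implicit Arguments. Unset Strict Implicit. Unset Printing Implicit Defensive.
Import Order.TTheory GRing.Theory Num.Theory.
Import numFieldNormedType.Exports.
Local Open Scope classical_set_scope.
Local Open Scope ring_scope.

Definition borel (T : ptopologicalType) := g_sigma_algebraType (@open T).

Definition locally_compact_space (T : topologicalType) :=
  forall x : T, exists2 C : set T, compact C & nbhs x C.

Definition sigma_compact_space (T : topologicalType) :=
  exists K : nat -> set T, (forall n, compact (K n)) /\ \bigcup_n K n = setT.

Definition metrizable_space (R : realType) (T : topologicalType) :=
  exists dist : T -> T -> R,
    [/\ forall x y, 0 <= dist x y,
        forall x y, dist x y = 0 <-> x = y,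
        forall x y, dist x y = dist y x,
        forall x y z, dist x z <= dist x y + dist y z &
        forall (x : T) (A : set T),
          nbhs x A <-> exists2 e : R, 0 < e & [set y | dist x y < e] `<=` A].

Definition lcsc_metrizable_group (R : realType) (G : ptopologicalType)
    (mul : G -> G -> G) (inv : G -> G) (one : G) :=
  [/\ (forall x y z, mul x (mul y z) = mul (mul x y) z),
      (forall x, mul one x = x /\ mul x one = x),
      (forall x, mul (inv x) x = one /\ mul x (inv x) = one),
      continuous (fun p : G * G => mul p.1 p.2) /\ continuous inv &
      [/\ locally_compact_space G, sigma_compact_space G &
          metrizable_space R G]].

Definition continuous_action (G X : ptopologicalType)
    (mul : G -> G -> G) (one : G) (act : G -> X -> X) :=
  [/\ forall x, act one x = x,
      forall g h x, act (mul g h) x = act g (act h x) &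
      continuous (fun p : G * X => act p.1 p.2)].

Section Conv.
Context (R : realType) (G X : ptopologicalType) (act : G -> X -> X).
Local Open Scope ereal_scope.

Definition conv (mu : set (borel G) -> \bar R) (nu : set (borel X) -> \bar R)
  : set (borel X) -> \bar R :=
  fun A => \int[mu]_(g in setT) nu (act g @^-1` A).

(* mu^{*n} * delta_x, i.e. the law of g_n ... g_1 x with g_i i.i.d. ~ mu,
   built as the n-fold iterated convolution mu * (mu * ( ... * delta_x)). *)
Definition conv_iter (mu : set (borel G) -> \bar R) (n : nat) (x : X)
  : set (borel X) -> \bar R :=
  iter n (conv mu) (@dirac _ (borel X) x R).

Definition cesaro (mu : set (borel G) -> \bar R) (n : nat) (x : X)
  (A : set (borel X)) : \bar R :=
  (n%:R^-1)%:E * \sum_(k < n) conv_iter mu k x A.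

Definition stationary (mu : set (borel G) -> \bar R)
  (nu : set (borel X) -> \bar R) :=
  forall A : set (borel X), measurable A -> conv mu nu A = nu A.

Definition invariant_measure (m : set (borel X) -> \bar R) :=
  forall g (A : set (borel X)), measurable A -> m (act g @^-1` A) = m A.

Definition ergodic_action (m : set (borel X) -> \bar R) :=
  forall A : set (borel X), measurable A ->
    (forall g, act g @^-1` A = A) -> m A = 0 \/ m A = 1.

Definition uniquely_ergodic (mu : set (borel G) -> \bar R)
  (m : probability (borel X) R) :=
  stationary mu m /\
  forall nu : probability (borel X) R, stationary mu nu ->
    forall A : set (borel X), measurable A -> nu A = m A.

Definition lura (mu : set (borel G) -> \bar R) :=
  forall K : set X, compact K -> forall eps : R, (0 < eps)%R ->
    exists n0 : nat, exists M : set X, compact M /\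
      forall (n : nat) (x : X), (n0 <= n)%N -> K x ->
        (1 - eps)%:E <= cesaro mu n x M.

End Conv.

Definition compactly_supported_continuous (R : realType) (X : topologicalType)
    (f : X -> R) :=
  continuous f /\ compact (closure [set x | f x != 0]).

(* Main.v *)
Require Import Defs.
From HB Require Import structures.
From mathcomp Require Import all_boot all_order all_algebra.
From mathcomp Require Import all_classical all_reals all_analysis.
From mathcomp Require Import measurable_realfun ring lra.
Set Implicit Arguments.
Unset Strict Implicit.
Unset Printing Implicit Defensive.
Import Order.TTheory GRing.Theory Num.Theory.
Import numFieldNormedType.Exports.
Local Open Scope classical_set_scope.
Local Open Scope ring_scope.

(** Suppose the uniform convergence fails along times [n_j] and starting points
    [x_j] in [K].  The averages along this sequence are tight by recurrence, so
    along an ultrafilter they have a weak limit [nu] (Prokhorov).  The action is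
    continuous, so the Markov operator preserves bounded continuous functions;
    since an average changes by at most [1/n] under one more step of the walk,
    [nu] is stationary.  Unique ergodicity gives [nu = mX], a contradiction.  The
    weak limit is obtained from the finitely additive ultralimit of the averages:
    its inner regularization by compact sets on open sets induces an outer measure
    for which open sets are Caratheodory measurable. *)

(** * Metrizable spaces and their Borel sets *)

Section metrizable.
Context (R : realType) (X : ptopologicalType).
Hypothesis mX : metrizable_space R X.

Lemma metrizable_zero_set (F : set X) : closed F ->
  exists d : X -> R, [/\ continuous d, forall x, 0 <= d x <= 1 &
    forall x, d x = 0 <-> F x].
Proof.
case: mX => dist [d0 deq dC dtri dnbhs] cF.
(* Adding 1 truncates the distance to [F] at 1 and keeps the infimum over a nonempty set even when
   [F] is empty. *)
pose S x := [set 1] `|` [set dist x y | y in F].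
have S1 x : S x 1 by left.
have S0 x : lbound (S x) 0 by move=> _ [->|[y _ <-]].
have hS x : has_inf (S x) by split; [exists 1|exists 0].
pose d x := inf (S x).
have dle x y : d x <= d y + dist x y.
  rewrite -lerBlDr; apply: lb_le_inf; first by exists 1.
  move=> _ [->|[z Fz <-]]; rewrite lerBlDr.
    rewrite (@le_trans _ _ 1)//; first by apply: ge_inf; [case: (hS x)|].
    by rewrite lerDl.
  rewrite (@le_trans _ _ (dist x z))//; last by rewrite addrC.
  by apply: ge_inf; [case: (hS x)|right; exists z].
exists d; split.
- move=> x; apply/cvgrPdist_lt => e e0; apply/dnbhs; exists e => // y /= xy.
  rewrite ltr_norml; have := dle x y; have := dle y x; rewrite (dC y x).
  by move=> *; apply/andP; split; lra.
- move=> x; apply/andP; split; first by apply: lb_le_inf; [exists 1|].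
  by apply: ge_inf; [case: (hS x)|].
- move=> x; split => [dx0|Fx].
  + apply: cF => A /dnbhs [e e0 eA].
    have : d x < Num.min 1 e by rewrite dx0 lt_min ltr01.
    move=> /(inf_lt (hS x).1) [_ [->|[y Fy <-]]]; first by rewrite lt_min ltxx.
    by rewrite lt_min => /andP[_ xye]; exists y; split => //; exact: eA.
  + apply/eqP; rewrite eq_le; apply/andP; split.
      by apply: ge_inf; [case: (hS x)|right; exists x => //; apply/deq].
    by apply: lb_le_inf; [exists 1|].
Qed.

Lemma metrizable_hausdorff : hausdorff_space X.
Proof.
case: mX => dist [d0 deq dC dtri dnbhs] x y xy; apply/deq/eqP.
apply/negPn/negP; rewrite neq_lt ltNge d0 /= => dxy.
have [||z [/= xz yz]] := xy [set z | dist x z < dist x y / 2]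
    [set z | dist y z < dist x y / 2].
- by apply/dnbhs; exists (dist x y / 2) => //; rewrite divr_gt0.
- by apply/dnbhs; exists (dist x y / 2) => //; rewrite divr_gt0.
by have := dtri x z y; rewrite (dC z y); lra.
Qed.

(** The sequential form of continuity is the one that dominated convergence can deliver for
    integrals depending on a parameter. *)
Lemma metrizable_sequential_continuous (f : X -> R) :
  (forall (u : nat -> X) x, u @ \oo --> x -> (f \o u) @ \oo --> f x) ->
  continuous f.
Proof.
case: mX => dist [d0 deq dC dtri dnbhs] fseq x; apply/cvgrPdist_lt => e e0.
apply: contrapT => nfx.
have /choice[u uP] n : exists y, dist x y < n.+1%:R^-1 /\ e <= `|f x - f y|.
  apply: contrapT => /forallNP h; apply: nfx; apply/dnbhs.
  exists n.+1%:R^-1 => //= y xy; rewrite ltNge; apply/negP => ?.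
  exact: (h y).
have ux : u @ \oo --> x.
  move=> A /dnbhs [r r0 rA].
  have := near_infty_natSinv_lt (PosNum r0).
  by apply: filterS => n /= nr; apply: rA => /=; exact: lt_trans (uP n).1 nr.
have /cvgrPdist_lt /(_ e e0) [N _ /(_ N (leqnn _))]/= := fseq u x ux.
by rewrite ltNge (uP N).2.
Qed.

(** Each [K i] has a finite cover by balls of radius [m.+1%:R^-1]; the balls of all these covers
    form a countable base, indexed by the pair [(i, m)] and the position in the list of centres. *)
Lemma sigma_compact_metrizable_countable_base : sigma_compact_space X ->
  exists (C : nat * nat -> nat -> set X),
    (forall p n, open (C p n)) /\
    forall x A, nbhs x A -> exists p n, C p n x /\ C p n `<=` A.
Proof.
case: mX => dist [d0 deq dC dtri dnbhs] [K [cK KT]].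
have bopen x e : open [set y | dist x y < e].
  rewrite openE => y /= xy; apply/dnbhs; exists (e - dist x y).
    by rewrite subr_gt0.
  by move=> z /= yz; have := dtri x y z; lra.
have /choice[s sP] (p : nat * nat) : exists s : seq X,
    K p.1 `<=` \bigcup_(x in [set` s]) [set y | dist x y < p.2.+1%:R^-1].
  have := cK p.1; rewrite compact_cover.
  case/(_ X setT (fun x => [set y | dist x y < p.2.+1%:R^-1])) => //.
    move=> x Kx; exists x => //=; rewrite (deq x x).2//.
  by move=> D _ KD; exists (finmap.enum_fset D).
(* Past the end of the list, [nth] returns [point]; this merely adds a further open ball to the
   family. *)
exists (fun p n => [set y | dist (nth point (s p) n) y < p.2.+1%:R^-1]).
split=> // x A /dnbhs [e e0 eA].
have [i _ Kix] : (\bigcup_n K n) x by rewrite KT.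
have e20 : 0 < e / 2 by rewrite divr_gt0.
have [m _ /(_ m (leqnn _))/= me] := near_infty_natSinv_lt (PosNum e20).
have {}me : m.+1%:R^-1 < e / 2 := me.
have [y ys /= yx] := sP (i, m) x Kix.
exists (i, m), (index y (s (i, m))); rewrite /= nth_index//; split=> //.
move=> z /= yz; apply: eA => /=.
move: (dtri x y z) (m.+1%:R^-1) me yx yz; rewrite (dC x y) => ? r; lra.
Qed.

End metrizable.

(** * Borel measurability of continuous maps and of the action *)

Section borel.

Lemma open_borel (X : ptopologicalType) (U : set X) :
  open U -> measurable (U : set (borel X)).
Proof. exact: sub_sigma_algebra. Qed.

Lemma closed_borel (X : ptopologicalType) (F : set X) :
  closed F -> measurable (F : set (borel X)).
Proof.
move=> cF; rewrite -(setCK F); apply: measurableC; apply: open_borel.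
exact: closed_openC.
Qed.

Lemma continuous_borel (R : realType) (X : ptopologicalType) (f : X -> R) :
  continuous f -> measurable_fun [set: borel X] f.
Proof.
move=> cf; apply: (measurability _ (RGenOpens.measurableE R)).
move=> _ [_ [a [b ->] <-]]; rewrite setTI.
apply: open_borel; apply: open_comp => //.
Qed.

(** Joint continuity alone makes preimages open in the product, whereas measurability refers to the
    product of the Borel sigma-algebras. A countable base of [G] writes each preimage as a countable
    union of open rectangles: [E p n] is the interior of the set of points that all of [C p n] sends
    into [U]. *)
Lemma action_measurable (R : realType) (G X : ptopologicalType)
    (act : G -> X -> X) :
  metrizable_space R G -> sigma_compact_space G ->
  continuous (fun p : G * X => act p.1 p.2) ->
  measurable_fun [set: borel G * borel X]
    ((fun p => act p.1 p.2) : borel G * borel X -> borel X).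
Proof.
move=> metG scG cact.
have [C [oC Cbase]] := sigma_compact_metrizable_countable_base metG scG.
apply: (@measurability _ _ (borel G * borel X)%type (borel X) setT
  (fun p => act p.1 p.2) (@open X) (erefl (@measurable _ (borel X))))
  => _ [U oU <-].
rewrite setTI.
pose E p n := interior [set x | forall g, C p n g -> U (act g x)].
rewrite (_ : _ @^-1` _ = \bigcup_p \bigcup_n (C p n `*` E p n)).
  apply: countable_bigcupT_measurable => // p.
  apply: bigcupT_measurable => n.
  by apply: measurableX; apply: open_borel => //; exact: open_interior.
apply/seteqP; split => [[g x] /= Ugx|[g x] [p _ [n _ [/= Cg]]]]; last first.
  by move=> /interior_subset /=; exact.
have : nbhs (g, x) [set p : G * X | U (act p.1 p.2)].
  by apply: cact; exact: open_nbhs_nbhs.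
case=> -[A B] [/= gA xB] AB.
have [p [n [Cg CA]]] := Cbase g A gA.
exists p => //; exists n => //; split => //=.
apply: filterS xB => y By h Ch; exact: (AB (h, y) (conj (CA _ Ch) By)).
Qed.

End borel.

(** A segment is compact, so the image ultrafilter has a cluster point, and an ultrafilter converges
    to any of its cluster points. *)
Lemma ultra_bounded_cvg (R : realType) (I : Type) (F : set_system I)
    (FU : UltraFilter F) (u : I -> R) (a b : R) :
  (forall i, a <= u i <= b) -> cvg (u @ F).
Proof.
move=> uab; have := @segment_compact R a b (u @ F) _.
case=> [|p [_ clp]].
  by apply: (@filterE _ F) => i; rewrite /= in_itv/= uab.
apply/cvg_ex; exists p => B Bp.
have [//|FnB] := in_ultra_setVsetC (u @^-1` B) FU.
by have [x [/= ? ?]] := clp (~` B) B FnB Bp.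
Qed.

(** * Compact sets in a metrizable space *)

Section compact_split.
Context (R : realType) (X : ptopologicalType).
Hypothesis mX : metrizable_space R X.

Lemma compact_borel (C : set X) : compact C -> measurable (C : set (borel X)).
Proof.
move=> cC; apply: closed_borel; apply: compact_closed => //.
exact: metrizable_hausdorff mX.
Qed.

(** Cut [C] according to which of the complements of [U] and [V] is farther away. A point of the
    first piece outside [U] would have both distances zero, hence lie outside [U] and [V]. *)
Lemma compact_split_open (C U V : set X) :
  compact C -> open U -> open V -> C `<=` U `|` V ->
  exists A B, [/\ compact A, compact B, A `<=` U, B `<=` V & C = A `|` B].
Proof.
move=> cC oU oV CUV.
have [d [cd d01 d0]] := metrizable_zero_set mX (open_closedC oU).
have [e [ce e01 e0]] := metrizable_zero_set mX (open_closedC oV).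
have cle (f g : X -> R) : continuous f -> continuous g ->
    compact (C `&` [set x | f x <= g x]).
  move=> cf cg; apply: compact_closedI => //.
  rewrite (_ : [set x | _] = (fun x => g x - f x) @^-1` [set r | 0 <= r]).
    apply: closed_comp; last exact: closed_ge.
    by move=> x _; apply: cvgB; [exact: cg|exact: cf].
  by apply/seteqP; split => x /=; rewrite subr_ge0.
exists (C `&` [set x | e x <= d x]), (C `&` [set x | d x <= e x]).
split; [exact: cle|exact: cle| | |].
- move=> x [Cx /= edx]; apply: contrapT => nUx.
  have dx0 := (d0 x).2 nUx; have [//|Vx] := CUV x Cx.
  have := (e0 x).1; apply => //; apply/eqP; rewrite eq_le.
  by rewrite -{1}dx0 edx; case/andP: (e01 x).
- move=> x [Cx /= dex]; apply: contrapT => nVx.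
  have ex0 := (e0 x).2 nVx; have [Ux|//] := CUV x Cx.
  have := (d0 x).1; apply => //; apply/eqP; rewrite eq_le.
  by rewrite -{1}ex0 dex; case/andP: (d01 x).
- apply/seteqP; split=> x; last by move=> [[]|[]].
  by move=> Cx; have [?|/ltW ?] := leP (e x) (d x); [left|right].
Qed.

End compact_split.

(** * Weak limits of tight families along an ultrafilter *)

Section prokhorov.
Context (R : realType) (X : ptopologicalType) (F : set_system nat).
Context {FU : UltraFilter F}.
Hypothesis metX : metrizable_space R X.
Variable P : nat -> probability (borel X) R.
Hypothesis tight : forall eps : R, 0 < eps ->
  exists M : set X, compact M /\ \forall i \near F, ((1 - eps)%:E <= P i M)%E.

Definition ulim_measure (A : set X) : R := lim (fine (P i A) @[i --> F]).
Local Notation m0 := ulim_measure.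

Let PE i A : measurable (A : set (borel X)) -> P i A = (fine (P i A))%:E.
Proof. by move=> mA; rewrite fineK// fin_num_measure. Qed.

Lemma ulim_measure_cvg A : measurable (A : set (borel X)) ->
  fine (P i A) @[i --> F] --> m0 A.
Proof.
move=> mA; apply: (@ultra_bounded_cvg _ _ _ _ _ 0 1) => i.
by rewrite fine_ge0//= -lee_fin -PE// probability_le1.
Qed.

Lemma ulim_measure_le1 A : measurable (A : set (borel X)) -> m0 A <= 1.
Proof.
move=> mA; apply: limr_le; first by apply/cvg_ex; exists (m0 A); exact: ulim_measure_cvg.
by apply: filterE => i; rewrite -lee_fin -PE// probability_le1.
Qed.

Lemma le_ulim_measure A B : measurable (A : set (borel X)) ->
  measurable (B : set (borel X)) -> A `<=` B -> m0 A <= m0 B.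
Proof.
move=> mA mB AB; apply: (ler_cvg_to (ulim_measure_cvg mA) (ulim_measure_cvg mB)).
by apply: filterE => i; rewrite -lee_fin -!PE//; apply: le_measure; rewrite ?inE.
Qed.

Lemma ulim_measureU A B : measurable (A : set (borel X)) ->
  measurable (B : set (borel X)) -> A `&` B = set0 ->
  m0 (A `|` B) = m0 A + m0 B.
Proof.
move=> mA mB AB0; apply: cvg_lim => //.
rewrite (_ : (fun i => _) = (fun i => fine (P i A) + fine (P i B))).
  by apply: cvgD; exact: ulim_measure_cvg.
by apply/funext => i; rewrite measureU// fineD// fin_num_measure.
Qed.

Lemma ulim_measureU_le A B : measurable (A : set (borel X)) ->
  measurable (B : set (borel X)) -> m0 (A `|` B) <= m0 A + m0 B.
Proof.
move=> mA mB; have -> : A `|` B = A `|` (B `\` A).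
  apply/seteqP; split => x [Ax|]; [by left| |by left|by case; right].
  by have [Ax|nAx] := pselect (A x); [left|right].
rewrite ulim_measureU//; last 2 first.
- exact: measurableD.
- by rewrite setDE setICA setICr setI0.
by rewrite lerD2l; apply: le_ulim_measure => //; exact: measurableD.
Qed.

Local Open Scope ereal_scope.

(** The ultralimit [m0] is only finitely additive. Keeping just the mass seen by compact sets is
    what restores countable subadditivity on open sets. *)
Definition inner_ulim (U : set X) : \bar R :=
  ereal_sup [set (m0 C)%:E | C in [set C | compact C /\ C `<=` U]].
Local Notation lam := inner_ulim.

Lemma inner_ulim_ge C U : compact C -> C `<=` U -> (m0 C)%:E <= lam U.
Proof. by move=> cC CU; apply: ereal_sup_ubound; exists C. Qed.

Lemma inner_ulim_le U x :
  (forall C, compact C -> C `<=` U -> (m0 C)%:E <= x) -> lam U <= x.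
Proof. by move=> h; apply: ge_ereal_sup => _ [C [cC CU] <-]; exact: h. Qed.

Let m0_set0 : m0 set0 = 0%R.
Proof.
apply: cvg_lim => //; under eq_fun do rewrite measure0.
exact: cvg_cst.
Qed.

Lemma inner_ulim_ge0 U : 0 <= lam U.
Proof.
have := @inner_ulim_ge set0 U (@compact0 X) (@sub0set _ U).
by rewrite m0_set0.
Qed.

Lemma inner_ulim_le1 U : lam U <= 1.
Proof.
apply: inner_ulim_le => C cC _; rewrite lee_fin.
by apply: ulim_measure_le1; exact: (compact_borel metX).
Qed.

Lemma inner_ulim_fin_num U : lam U \is a fin_num.
Proof.
by rewrite ge0_fin_numE ?inner_ulim_ge0// (le_lt_trans (inner_ulim_le1 U))// ltry.
Qed.

Lemma le_inner_ulim U V : U `<=` V -> lam U <= lam V.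
Proof.
move=> UV; apply: inner_ulim_le => C cC CU.
by apply: inner_ulim_ge => //; exact: subset_trans UV.
Qed.

Lemma inner_ulim0 : lam set0 = 0.
Proof.
apply/eqP; rewrite eq_le inner_ulim_ge0 andbT; apply: inner_ulim_le => C _.
by rewrite subset0 => ->; rewrite m0_set0.
Qed.

Lemma inner_ulimU U V : open U -> open V -> lam (U `|` V) <= lam U + lam V.
Proof.
move=> oU oV; apply: inner_ulim_le => C cC CUV.
have [A [B [cA cB AU BV ->]]] := compact_split_open metX cC oU oV CUV.
apply: (@le_trans _ _ ((m0 A)%:E + (m0 B)%:E)).
  by rewrite -EFinD lee_fin; apply: ulim_measureU_le; exact: (compact_borel metX).
by apply: leeD; exact: inner_ulim_ge.
Qed.

(** A compact subset of the union is already covered by finitely many of the [U n], so finite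
    subadditivity suffices. *)
Lemma inner_ulim_bigcup (U : (set X)^nat) : (forall n, open (U n)) ->
  lam (\bigcup_n U n) <= \sum_(n <oo) lam (U n).
Proof.
move=> oU; pose V n := \big[setU/set0]_(i < n) U i.
have oV n : open (V n) by rewrite /V; apply: big_ind => //; [exact: open0|exact: openU].
have lamV n : lam (V n) <= \sum_(i < n) lam (U i).
  elim: n => [|n ih]; first by rewrite /V !big_ord0 inner_ulim0.
  rewrite /V !big_ord_recr/=; apply: (le_trans (inner_ulimU (oV n) (oU n))).
  by rewrite leeD2r.
apply: inner_ulim_le => C cC CU.
have [n CV] : exists n, C `<=` V n.
  have := cC; rewrite compact_cover => /(_ nat setT U (fun i _ => oU i)).
  case=> // D _ CD; exists (\max_(i <- finmap.enum_fset D) i).+1 => x /CD [i /= iD Uix].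
  rewrite /V -bigcup_mkord; exists i => //=; rewrite ltnS.
  exact: leq_bigmax_seq.
apply: (le_trans (inner_ulim_ge cC CV)); apply: (le_trans (lamV n)).
rewrite -(big_mkord xpredT (lam \o U)).
by apply: nneseries_lim_ge => i _ _; exact: inner_ulim_ge0.
Qed.

Definition outer_ulim (A : set X) : \bar R :=
  ereal_inf [set lam U | U in [set U | open U /\ A `<=` U]].
Local Notation nu := outer_ulim.

Lemma outer_ulim_le A U : open U -> A `<=` U -> nu A <= lam U.
Proof. by move=> oU AU; apply: ereal_inf_lbound; exists U. Qed.

Lemma outer_ulim_ge A x :
  (forall U, open U -> A `<=` U -> x <= lam U) -> x <= nu A.
Proof. by move=> h; apply: le_ereal_inf_tmp => _ [U [oU AU] <-]; exact: h. Qed.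

Lemma outer_ulim_open U : open U -> nu U = lam U.
Proof.
move=> oU; apply/eqP; rewrite eq_le outer_ulim_le//=.
by apply: outer_ulim_ge => V oV UV; exact: le_inner_ulim.
Qed.

Let nu_ge0 A : 0 <= nu A.
Proof. by apply: outer_ulim_ge => U _ _; exact: inner_ulim_ge0. Qed.

Let nu0 : nu set0 = 0.
Proof. by rewrite outer_ulim_open ?inner_ulim0//; exact: open0. Qed.

Let le_nu : {homo nu : A B / A `<=` B >-> A <= B}.
Proof.
move=> A B AB; apply: outer_ulim_ge => U oU BU.
by apply: outer_ulim_le => //; exact: subset_trans BU.
Qed.

Let nu_fin A : nu A \is a fin_num.
Proof.
rewrite ge0_fin_numE// (@le_lt_trans _ _ 1)// ?ltry//.
by rewrite (le_trans (outer_ulim_le openT (@subsetT _ A)))// inner_ulim_le1.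
Qed.

Let nu_sigma_subadditive : sigma_subadditive nu.
Proof.
move=> A; apply/lee_addgt0Pr => e e0.
rewrite (le_trans _ (epsilon_trick _ _ (ltW e0)))//.
have /choice[G GP] n : exists U, [/\ open U, A n `<=` U &
    lam U <= nu (A n) + (e / (2 ^ n.+1)%:R)%:E].
  have en : (0 < e / (2 ^ n.+1)%:R)%R by rewrite divr_gt0// ltr0n expn_gt0.
  have [_ [U [oU AU] <-] /ltW] := lb_ereal_inf_adherent en (nu_fin (A n)).
  by exists U.
have oG n : open (G n) by case: (GP n).
apply: (@le_trans _ _ (lam (\bigcup_n G n))).
  apply: outer_ulim_le; first exact: bigcup_open.
  by apply: subset_bigcup => n _; case: (GP n).
apply: (le_trans (inner_ulim_bigcup oG)).
apply: lee_nneseries => [n _ _|n _]; first exact: inner_ulim_ge0.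
by case: (GP n).
Qed.

HB.instance Definition _ :=
  isOuterMeasure.Build R X nu nu0 nu_ge0 le_nu nu_sigma_subadditive.

(** For an open [W] containing [A], take a compact [C] nearly exhausting [W] inside [U], then a
    compact [D] nearly exhausting the open set [W] minus [C], which contains the part of [A] outside
    [U]. As [C] and [D] are disjoint in [W], their masses add up to at most [lam W]. *)
Lemma outer_ulim_caratheodory_open U : open U -> nu.-caratheodory U.
Proof.
move=> oU; apply: le_caratheodory_measurable => A.
apply: outer_ulim_ge => W oW AW.
apply/lee_addgt0Pr => e e0.
have e20 : (0 < e / 2)%R by rewrite divr_gt0.
have [_ [C [cC CWU] <-] lamC] := ub_ereal_sup_adherent e20 (inner_ulim_fin_num (W `&` U)).
have oWC : open (W `\` C).
  apply: openI => //; apply: closed_openC; apply: compact_closed => //.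
  exact: metrizable_hausdorff metX.
have [_ [D [cD DWC] <-] lamD] := ub_ereal_sup_adherent e20 (inner_ulim_fin_num (W `\` C)).
have lamWU : nu (A `&` U) <= lam (W `&` U).
  by apply: outer_ulim_le; [exact: openI|exact: setSI].
have lamWC : nu (A `&` ~` U) <= lam (W `\` C).
  apply: outer_ulim_le => // x [Ax nUx]; split; first exact: AW.
  by move=> /CWU [].
apply: (le_trans (leeD lamWU lamWC)).
have : (m0 C)%:E + (m0 D)%:E <= lam W.
  rewrite -EFinD -ulim_measureU; last 3 first.
  - exact: (compact_borel metX) cC.
  - exact: (compact_borel metX) cD.
  - by apply/seteqP; split => // x [Cx /DWC []].
  apply: inner_ulim_ge; first exact: compactU.
  by move=> x [/CWU []|/DWC []].
move: (inner_ulim_fin_num (W `&` U)) (inner_ulim_fin_num (W `\` C))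
  (inner_ulim_fin_num W) lamC lamD; rewrite -/(lam _) -/(lam _).
move: (lam _) (lam _) (lam _) => [a| |] [b| |] [c| |]// _ _ _.
by rewrite -!EFinB -!EFinD !lte_fin !lee_fin; lra.
Qed.

Lemma outer_ulim_caratheodory A : measurable (A : set (borel X)) ->
  nu.-caratheodory A.
Proof.
have : <<s @open X >> `<=` nu.-cara.-measurable.
  apply: smallest_sub; first exact: sigma_algebra_measurable.
  by move=> U oU; exact: outer_ulim_caratheodory_open.
exact.
Qed.

(** The same set function, retyped on [borel X] so that it can carry a measure structure for the
    Borel sigma-algebra. *)
Definition borel_ulim (A : set (borel X)) : \bar R := nu A.
Local Notation nuB := borel_ulim.

Let nuB_sigma_additive : semi_sigma_additive nuB.
Proof.
move=> A mA tA mUA; apply: (@caratheodory_measure_sigma_additive R X nu) => //.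
  by move=> i; exact: outer_ulim_caratheodory.
exact: outer_ulim_caratheodory.
Qed.

HB.instance Definition _ :=
  isMeasure.Build _ _ _ nuB nu0 nu_ge0 nuB_sigma_additive.

(** Tightness enters here: up to [e], all mass stays in one compact set along [F], so none is lost
    in the limit. *)
Let nuB_setT : nuB setT = 1.
Proof.
rewrite /nuB outer_ulim_open; last exact: openT.
apply/eqP; rewrite eq_le inner_ulim_le1/=; apply/lee_addgt0Pr => e e0.
have [M [cM PM]] := tight e0.
have mM : measurable (M : set (borel X)) by exact: (compact_borel metX).
apply: (@le_trans _ _ ((m0 M)%:E + e%:E)); last first.
  by rewrite leeD2r// inner_ulim_ge.
rewrite -EFinD lee_fin -lerBlDr; apply: limr_ge.
  by apply/cvg_ex; exists (m0 M); exact: ulim_measure_cvg.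
by apply: filterS PM => i; rewrite PE// lee_fin.
Qed.

HB.instance Definition _ := Measure_isProbability.Build _ _ _ nuB nuB_setT.

Definition prokhorov_limit : probability (borel X) R := nuB.

(** The portmanteau inequality for open sets, through which the limit measure is compared with the
    [P i]. *)
Lemma prokhorov_limit_open U : open U -> prokhorov_limit U <= (m0 U)%:E.
Proof.
move=> oU; rewrite /prokhorov_limit /= /nuB outer_ulim_open//.
apply: inner_ulim_le => C cC CU; rewrite lee_fin; apply: le_ulim_measure => //.
- exact: (compact_borel metX).
- exact: open_borel.
Qed.

End prokhorov.

(** Normalised test functions: the class is stable under [1 - h] and under the Markov operator, and
    the constant 1 dominates all of it. *)
Definition unit_continuous (R : realType) (X : topologicalType) (h : X -> R) :=
  continuous h /\ forall x, 0 <= h x <= 1.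

(** * Integrals of functions with values in the unit interval *)

Section unit_measurable.
Context d (T : measurableType d) (R : realType) (Q : probability T R).

Lemma unit_integrable (h : T -> R) : measurable_fun setT h ->
  (forall x, 0 <= h x <= 1) -> Q.-integrable setT (EFin \o h).
Proof.
move=> mh h01; apply: measurable_bounded_integrable => //.
  by rewrite -ge0_fin_numE// fin_num_measure.
exists 1; split; first exact: num_real.
move=> y y1 x _ /=; have /andP[h0 h1] := h01 x.
by rewrite ger0_norm//; exact: le_trans (ltW y1).
Qed.

Lemma Rintegral_probability_cst (c : R) : \int[Q]_(x in setT) c = c.
Proof.
transitivity (c * fine (Q setT)); first exact: Rintegral_cst.
by rewrite probability_setT mulr1.
Qed.

Lemma unit_Rintegral (h : T -> R) : measurable_fun setT h ->
  (forall x, 0 <= h x <= 1) -> 0 <= \int[Q]_x h x <= 1.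
Proof.
move=> mh h01; apply/andP; split.
  by apply: Rintegral_ge0 => x _; case/andP: (h01 x).
rewrite -[leRHS]Rintegral_probability_cst.
apply: le_Rintegral => //.
- exact: unit_integrable.
- exact: finite_measure_integrable_cst.
- by move=> x _; case/andP: (h01 x).
Qed.

Lemma Rintegral_onem (h : T -> R) : measurable_fun setT h ->
  (forall x, 0 <= h x <= 1) -> \int[Q]_x (1 - h x) = 1 - \int[Q]_x h x.
Proof.
move=> mh h01; rewrite RintegralB//; last 2 first.
- exact: finite_measure_integrable_cst.
- exact: unit_integrable.
by rewrite Rintegral_probability_cst.
Qed.

Lemma Rintegral_sum_indic (A : nat -> set T) n : (forall k, measurable (A k)) ->
  Q.-integrable setT (EFin \o (fun x => \sum_(k < n) \1_(A k) x)) /\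
  \int[Q]_x (\sum_(k < n) \1_(A k) x) = \sum_(k < n) fine (Q (A k)).
Proof.
move=> mA; elim: n => [|n [ih1 ih2]].
  split.
    under eq_fun do rewrite big_ord0.
    exact: finite_measure_integrable_cst.
  by under eq_Rintegral do rewrite big_ord0; rewrite Rintegral_probability_cst big_ord0.
have iA : Q.-integrable setT (EFin \o \1_(A n)) by exact: integrable_indic.
split.
  rewrite (_ : EFin \o _ = (EFin \o (fun x => (\sum_(k < n) \1_(A k) x)%R)) \+
      (EFin \o \1_(A n)))%E; first exact: integrableD.
  by apply/funext => x /=; rewrite big_ord_recr.
under eq_Rintegral do rewrite big_ord_recr /=.
by rewrite RintegralD// ih2 big_ord_recr/= /Rintegral integral_indic// setIT.
Qed.

(** The sum counts the naturals below [t], so it is the ceiling of [t]. *)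
Lemma staircase (t : R) n : 0 <= t <= n%:R ->
  t <= \sum_(k < n) (k%:R < t)%R%:R <= t + 1.
Proof.
elim: n => [|n ih] /andP[t0 tn].
  by rewrite big_ord0 tn addr_ge0.
rewrite big_ord_recr/=; have [tn'|nt] := leP t n%:R.
  by rewrite addr0; apply: ih; rewrite t0.
rewrite (eq_bigr (fun=> 1)); last first.
  by move=> k _; rewrite (le_lt_trans _ nt)// ler_nat ltnW.
rewrite sumr_const card_ord; move: tn; rewrite -natr1 => tn.
by rewrite tn lerD2r ltW.
Qed.

(* Discretised layer cake formula; it bounds integrals through measures of open
   sets, on which the limit measure is controlled. *)
Lemma Rintegral_staircase (h : T -> R) n : measurable_fun setT h ->
  (forall x, 0 <= h x <= 1) ->
  n.+1%:R * \int[Q]_x h x <=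
    \sum_(k < n.+1) fine (Q [set x | k%:R < n.+1%:R * h x])
    <= n.+1%:R * \int[Q]_x h x + 1.
Proof.
move=> mh h01; pose A k := [set x : T | k%:R < n.+1%:R * h x].
have mA k : measurable (A k).
  rewrite (_ : A k = setT `&` (fun x => n.+1%:R * h x) @^-1` `]k%:R, +oo[); last first.
    by apply/seteqP; split=> x; rewrite /A /= in_itv/= andbT// => -[].
  have : measurable_fun setT (fun x => n.+1%:R * h x) by exact: measurable_funM.
  by apply => //; exact: measurable_itv.
have [iS <-] := Rintegral_sum_indic n.+1 mA.
have ih : Q.-integrable setT (EFin \o (fun x => n.+1%:R * h x)).
  by have := integrableZl measurableT n.+1%:R (unit_integrable mh h01).
have i1 : Q.-integrable setT (EFin \o cst (1 : R)).
  exact: finite_measure_integrable_cst.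
have st x : n.+1%:R * h x <= \sum_(k < n.+1) \1_(A k) x <= n.+1%:R * h x + 1.
  rewrite (eq_bigr (fun k : 'I_n.+1 => (k%:R < n.+1%:R * h x)%R%:R)); last first.
    by move=> k _; rewrite indicE /A mem_setE.
  apply: staircase; have /andP[h0 h1] := h01 x.
  by rewrite mulr_ge0//= ler_piMr.
rewrite -RintegralZl//; last exact: unit_integrable.
apply/andP; split.
  by apply: le_Rintegral => // x _; case/andP: (st x).
rewrite -[X in _ + X]Rintegral_probability_cst.
rewrite -RintegralD//.
have i2 : Q.-integrable setT (EFin \o (fun x => n.+1%:R * h x + 1)).
  have := integrableD measurableT ih i1. exact.
apply: le_Rintegral => //.
by move=> x _; case/andP: (st x).
Qed.

End unit_measurable.

(** * Convergence of integrals to the weak limit *)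

Section prokhorov_limit_Rintegral.
Context (R : realType) (X : ptopologicalType) (F : set_system nat).
Context {FU : UltraFilter F}.
Hypothesis metX : metrizable_space R X.
Variable P : nat -> probability (borel X) R.
Hypothesis tight : forall eps : R, 0 < eps ->
  exists M : set X, compact M /\ \forall i \near F, ((1 - eps)%:E <= P i M)%E.
Local Notation nu := (prokhorov_limit metX tight).

Let unit_measurable h : unit_continuous h -> measurable_fun [set: borel X] (h : X -> R).
Proof. by case=> ch _; exact: continuous_borel. Qed.

Let cvgP h : unit_continuous h ->
  cvg (\int[P i]_(x in setT) (h x : R) @[i --> F]).
Proof.
move=> uh; apply: (@ultra_bounded_cvg _ _ _ _ _ 0 1) => i.
by apply: unit_Rintegral; [exact: unit_measurable|exact: uh.2].
Qed.

Lemma le_Rintegral_prokhorov_limit h : unit_continuous h ->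
  \int[nu]_x (h x : R) <= lim (\int[P i]_(x in setT) (h x : R) @[i --> F]).
Proof.
move=> uh; have mh := unit_measurable uh; have [ch h01] := uh.
apply/ler_addgt0Pr => e e0.
(* With [n.+1] levels the staircase is off by at most 1 after scaling by [n.+1], that is by less
   than [e] in the integral. *)
have [n _ /(_ n (leqnn _))/ltW] := near_infty_natSinv_lt (PosNum e0).
rewrite [leRHS]/= => ne; apply: le_trans (lerD (lexx _) ne).
have n0 : 0 < n.+1%:R :> R by rewrite ltr0n.
rewrite -(ler_pM2l n0) mulrDr divff ?lt0r_neq0//.
have [+ _] := andP (Rintegral_staircase nu n mh h01).
move/le_trans; apply.
pose U k := [set x : X | k%:R < n.+1%:R * h x].
have oU k : open (U k).
  rewrite (_ : U k = (fun x => n.+1%:R * h x) @^-1` [set r | k%:R < r])//.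
  apply: open_comp; last exact: open_gt.
  by move=> x _; apply: cvgM; [exact: cvg_cst|exact: ch].
apply: (@le_trans _ _ (\sum_(k < n.+1) ulim_measure F P (U k))).
  apply: ler_sum => k _; have mU := open_borel (oU k).
  rewrite -lee_fin; apply: le_trans (prokhorov_limit_open metX tight (oU k)).
  by rewrite fineK// fin_num_measure.
have cvgS : (\sum_(k < n.+1) fine (P i (U k))) @[i --> F] -->
    \sum_(k < n.+1) ulim_measure F P (U k).
  elim: n.+1 => [|m ihm].
    by rewrite big_ord0; under eq_fun do rewrite big_ord0; exact: cvg_cst.
  rewrite big_ord_recr/=; under eq_fun do rewrite big_ord_recr/=.
  by apply: cvgD ihm _; apply: ulim_measure_cvg; exact: open_borel.
have cvgI : n.+1%:R * \int[P i]_(x in setT) (h x : R) + 1 @[i --> F] -->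
    n.+1%:R * lim (\int[P i]_(x in setT) (h x : R) @[i --> F]) + 1.
  by apply: cvgD; [apply: cvgM; [exact: cvg_cst|exact: cvgP]|exact: cvg_cst].
apply: (ler_cvg_to cvgS cvgI); apply: filterE => i.
by case/andP: (Rintegral_staircase (P i) n mh h01).
Qed.

(* The reverse inequality is the previous one applied to [1 - h]. *)
Lemma prokhorov_limit_cvg h : unit_continuous h ->
  \int[P i]_(x in setT) (h x : R) @[i --> F] --> \int[nu]_x (h x : R).
Proof.
move=> uh; have mh := unit_measurable uh; have [ch h01] := uh.
have uh' : unit_continuous (fun x => 1 - h x).
  split; first by move=> x; apply: cvgB; [exact: cvg_cst|exact: ch].
  by move=> x; rewrite subr_ge0 gerBl andbC; exact: h01.
have -> : \int[nu]_x h x = lim (\int[P i]_(x in setT) h x @[i --> F]); last exact: cvgP.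
apply/eqP; rewrite eq_le le_Rintegral_prokhorov_limit//=.
have := le_Rintegral_prokhorov_limit uh'.
rewrite Rintegral_onem//.
rewrite (_ : (fun i => _) = (fun i => 1 - \int[P i]_(x in setT) h x)); last first.
  by apply/funext => i; rewrite Rintegral_onem.
have -> : lim (1 - \int[P i]_(x in setT) h x @[i --> F]) =
    1 - lim (\int[P i]_(x in setT) h x @[i --> F]).
  by apply: cvg_lim => //; apply: cvgB; [exact: cvg_cst|exact: cvgP].
by rewrite lerD2l lerN2.
Qed.

End prokhorov_limit_Rintegral.

(** * Continuous functions determine Borel probability measures *)

Lemma unit_continuous_measurable (R : realType) (X : ptopologicalType)
    (h : X -> R) : unit_continuous h -> measurable_fun [set: borel X] h.
Proof. by case=> ch _; exact: continuous_borel. Qed.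

Lemma unit_dominated_cvg d (T : measurableType d) (R : realType)
    (Q : probability T R) (h_ : nat -> T -> R) (h : T -> R) :
  (forall n, measurable_fun setT (h_ n)) -> measurable_fun setT h ->
  (forall n x, 0 <= h_ n x <= 1) -> (forall x, 0 <= h x <= 1) ->
  (forall x, h_ ^~ x @ \oo --> h x) ->
  \int[Q]_(x in setT) h_ n x @[n --> \oo] --> \int[Q]_x h x.
Proof.
move=> mh_ mh h_01 h01 cvgh; apply: fine_cvg.
rewrite fineK; last exact: integrable_fin_num (unit_integrable Q mh h01).
apply: (@dominated_cvg _ _ _ Q setT measurableT (fun n x => (h_ n x)%:E)
  (fun x => (h x)%:E) (cst 1%E)) => //.
- by move=> n; exact/measurable_EFinP.
- by move=> x _; apply: cvg_EFin; [exact: nearW|exact: cvgh].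
- exact: finite_measure_integrable_cst.
- by move=> n x _; have /andP[h0 h1] := h_01 n x; rewrite lee_fin ger0_norm.
Qed.

(** Open sets are a generating family closed under intersection, and the indicator of an open [U] is
    the pointwise limit of [Num.min 1 (n%:R * d x)], where [d] vanishes exactly off [U]. *)
Lemma unit_continuous_measure_unique (R : realType) (X : ptopologicalType)
    (m1 m2 : probability (borel X) R) : metrizable_space R X ->
  (forall h : X -> R, unit_continuous h -> \int[m1]_x h x = \int[m2]_x h x) ->
  forall A : set (borel X), measurable A -> m1 A = m2 A.
Proof.
move=> metX m12.
suff m12U (U : set (borel X)) : open (U : set X) -> m1 U = m2 U.
  apply: (@g_sigma_algebra_measure_unique _ R (borel X) (@open X) _ (fun=> setT)).
  - by move=> U; exact: open_borel.
  - by move=> _; exact: openT.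
  - by rewrite bigcup_const.
  - by move=> U V; exact: openI.
  - by move=> U oU; exact: m12U.
  - by move=> _; rewrite -ge0_fin_numE// fin_num_measure.
move=> oU; have [d [cd d01 d0]] := metrizable_zero_set metX (open_closedC oU).
pose h n (x : X) := Num.min 1 (n%:R * d x).
have uh n : unit_continuous (h n).
  split=> [x|x].
    apply: (@continuous_min R X (cst 1) (fun x => n%:R * d x)).
      exact: cvg_cst.
    by apply: cvgM; [exact: cvg_cst|exact: cd].
  have /andP[dx0 _] := d01 x.
  by rewrite /h le_min ler01 mulr_ge0//= ge_min lexx.
have mU : measurable U by exact: open_borel.
have hU (m : probability (borel X) R) :
    \int[m]_(x in setT) h n x @[n --> \oo] --> fine (m U).
  have -> : fine (m U) = \int[m]_x \1_U x by rewrite /Rintegral integral_indic// setIT.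
  apply: unit_dominated_cvg => //.
  - by move=> n; exact: unit_continuous_measurable (uh n).
  - by move=> n x; exact: (uh n).2.
  - by move=> x; rewrite indicE; case: (_ \in _); rewrite ?lexx ?ler01.
  move=> x; rewrite indicE; have [xU|xU] := boolP (x \in U); last first.
    rewrite (_ : h ^~ x = cst 0); first exact: cvg_cst.
    apply/funext => n; rewrite /h (d0 x).2 ?mulr0 ?(min_r ler01)//.
    by move: xU; rewrite notin_setE.
  have dx0 : 0 < d x.
    have /andP[+ _] := d01 x; rewrite le_eqVlt => /predU1P[/esym/d0|//].
    by move: xU; rewrite inE.
  apply: cvg_near_cst; near=> n; rewrite /h min_l//.
  rewrite -ler_pdivrMr// mul1r; near: n.
  exact: nbhs_infty_ger.
have m12h : (fun n => \int[m1]_(x in setT) h n x) = (fun n => \int[m2]_(x in setT) h n x).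
  by apply/funext => n; exact: m12.
have m12U : fine (m1 U) = fine (m2 U).
  by have := hU m1; rewrite m12h => h1; rewrite -(cvg_lim _ h1)// (cvg_lim _ (hU m2)).
by rewrite -(fineK (fin_num_measure m1 _ mU)) m12U fineK ?fin_num_measure.
Unshelve. all: by end_near. Qed.

(** * The random walk and its Cesaro averages *)

Section convolution.
Context (R : realType) (G X : ptopologicalType) (act : G -> X -> X).
Variable mu : probability (borel G) R.
Hypothesis metG : metrizable_space R G.
Hypothesis scG : sigma_compact_space G.
Hypothesis metX : metrizable_space R X.
Hypothesis cact : continuous (fun p : G * X => act p.1 p.2).

Let actp : borel G * borel X -> borel X := fun p => act p.1 p.2.

Let mactp : measurable_fun setT actp.
Proof. exact: action_measurable metG scG cact. Qed.

Section conv_prob.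
Variable nu : probability (borel X) R.

(** The convolution is the law of [act g x] for independent [g] and [x]; the measure axioms are then
    inherited from the image of the product measure. *)
Lemma conv_pushforward : Defs.conv act mu nu = pushforward (mu \x nu)%E actp.
Proof.
apply/funext => A; apply: eq_integral => g _ /=; congr (nu _).
by rewrite xsectionE.
Qed.

Let conv0 : Defs.conv act mu nu set0 = 0%E.
Proof. by rewrite conv_pushforward measure0. Qed.

Let conv_ge0 A : (0 <= Defs.conv act mu nu A)%E.
Proof. by rewrite conv_pushforward; exact: measure_ge0. Qed.

Let conv_sigma_additive : semi_sigma_additive (Defs.conv act mu nu).
Proof. by rewrite conv_pushforward; exact: measure_semi_sigma_additive. Qed.

HB.instance Definition _ := isMeasure.Build _ _ _ (Defs.conv act mu nu)
  conv0 conv_ge0 conv_sigma_additive.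

Let conv_setT : Defs.conv act mu nu setT = 1%E.
Proof. by rewrite conv_pushforward /pushforward preimage_setT probability_setT. Qed.

HB.instance Definition _ :=
  Measure_isProbability.Build _ _ _ (Defs.conv act mu nu) conv_setT.

Definition conv_prob : probability (borel X) R := Defs.conv act mu nu.

End conv_prob.

Definition markov_op (h : X -> R) (x : X) : R :=
  \int[mu]_g (h (act g x) : R).

Let cact_l x : continuous (act^~ x : G -> X).
Proof.
move=> g; apply: (@continuous_comp _ _ _ (fun g => (g, x)) (fun p => act p.1 p.2)).
  by apply: cvg_pair; [exact: cvg_id|exact: cvg_cst].
exact: cact.
Qed.

Let cact_r g : continuous (act g).
Proof.
move=> x; apply: (@continuous_comp _ _ _ (fun x => (g, x)) (fun p => act p.1 p.2)).
  by apply: cvg_pair; [exact: cvg_cst|exact: cvg_id].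
exact: cact.
Qed.

Let mact_l h x : unit_continuous h ->
  measurable_fun [set: borel G] (fun g => h (act g x) : R).
Proof.
case=> ch _; apply: continuous_borel => g.
by apply: continuous_comp; [exact: cact_l|exact: ch].
Qed.

(** The Feller property: along a convergent sequence of points the integrands converge pointwise in
    [g] and are dominated by 1. *)
Lemma unit_continuous_markov h : unit_continuous h -> unit_continuous (markov_op h).
Proof.
move=> uh; have [ch h01] := uh; split.
  apply: (metrizable_sequential_continuous metX) => u x ux.
  apply: unit_dominated_cvg => //.
  - by move=> n; exact: mact_l.
  - exact: mact_l.
  move=> g; apply: continuous_cvg; first exact: ch.
  by apply: continuous_cvg; first exact: cact_r.
by move=> x; apply: unit_Rintegral => //; exact: mact_l.
Qed.

(** Duality between convolution by [mu] and the Markov operator: change of variables, then Tonelli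
    with the integral over [g] inside. *)
Lemma Rintegral_conv_prob nu h : unit_continuous h ->
  \int[conv_prob nu]_x (h x : R) = \int[nu]_x markov_op h x.
Proof.
move=> uh; have [ch h01] := uh; have mh := unit_continuous_measurable uh.
have h0 x : (0 <= (h x)%:E)%E by rewrite lee_fin; case/andP: (h01 x).
rewrite /Rintegral /conv_prob /= conv_pushforward ge0_integral_pushforward//; last first.
  exact/measurable_EFinP.
rewrite preimage_setT fubini_tonelli2//=; last first.
  by apply: measurableT_comp mactp; exact/measurable_EFinP.
congr fine; apply: eq_integral => x _; rewrite /fubini_G /markov_op /Rintegral fineK//.
exact: integrable_fin_num (unit_integrable mu (mact_l x uh) (fun g => h01 (act g x))).
Qed.

(** The iterates with their probability structure carried along, so that integration lemmas apply at
    every step. *)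
Fixpoint conv_iter_prob (x : X) (k : nat) : probability (borel X) R :=
  if k is k'.+1 then conv_prob (conv_iter_prob x k') else @dirac _ (borel X) x R.

Lemma conv_iter_probE x k : conv_iter_prob x k = conv_iter act mu k x :> (set _ -> _).
Proof. by elim: k => //= k ih; rewrite /conv_prob /= ih. Qed.

Let msum_setT x n : msum (conv_iter_prob x) n setT = n%:R%:E.
Proof.
rewrite /msum (eq_bigr (fun=> 1%E)); last by move=> k _; exact: probability_setT.
by rewrite sumEFin sumr_const card_ord.
Qed.

Section cesaro_prob.
Variables (n : nat) (x : X).

(** Index [n] stands for the average of [n.+1] terms, since the empty average has total mass 0. *)
Let invn : {nonneg R} := n.+1%:R^-1%:nng.

Let ces := mscale invn (msum (conv_iter_prob x) n.+1).

HB.instance Definition _ := Measure.on ces.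

Let ces_setT : ces setT = 1%E.
Proof.
transitivity ((n.+1%:R^-1)%:E * n.+1%:R%:E : \bar R)%E.
  by congr (_ * _)%E; exact: msum_setT.
by rewrite -EFinM mulVf.
Qed.

HB.instance Definition _ := Measure_isProbability.Build _ _ _ ces ces_setT.

Definition cesaro_prob : probability (borel X) R := ces.

Lemma cesaro_probE A : cesaro_prob A = Defs.cesaro act mu n.+1 x A.
Proof.
rewrite /cesaro_prob /= /ces /mscale /msum /Defs.cesaro; congr (_ * _)%E.
by apply: eq_bigr => k _; have := congr1 (@^~ A) (conv_iter_probE x k).
Qed.

Lemma Rintegral_cesaro_prob h : unit_continuous h ->
  \int[cesaro_prob]_y (h y : R) =
  n.+1%:R^-1 * \sum_(k < n.+1) \int[conv_iter_prob x k]_y (h y : R).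
Proof.
move=> uh; have [ch h01] := uh; have mh := unit_continuous_measurable uh.
have h0 y : (0 <= (h y)%:E)%E by rewrite lee_fin; case/andP: (h01 y).
have mEh : measurable_fun [set: borel X] (EFin \o h) by exact/measurable_EFinP.
rewrite {1}/Rintegral /cesaro_prob /= /ces ge0_integral_mscale//.
rewrite ge0_integral_measure_sum// (eq_bigr (fun k : 'I_n.+1 =>
    (\int[conv_iter_prob x k]_y (h y : R))%:E)); last first.
  move=> k _; rewrite /Rintegral fineK//.
  exact: integrable_fin_num (unit_integrable _ mh h01).
by rewrite sumEFin -EFinM.
Qed.

(** By duality the difference telescopes to the integral at time [n.+1] minus the one at time 0,
    both in the unit interval. *)
Lemma cesaro_prob_markov h : unit_continuous h ->
  `| \int[cesaro_prob]_y markov_op h y - \int[cesaro_prob]_y (h y : R) | <=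
  n.+1%:R^-1.
Proof.
move=> uh; rewrite !Rintegral_cesaro_prob//; last exact: unit_continuous_markov.
rewrite -mulrBr -sumrB.
rewrite (eq_bigr (fun k : 'I_n.+1 => \int[conv_iter_prob x k.+1]_y (h y : R) -
    \int[conv_iter_prob x k]_y (h y : R))); last first.
  by move=> k _; rewrite /= Rintegral_conv_prob.
rewrite -(big_mkord xpredT (fun k => \int[conv_iter_prob x k.+1]_y (h y : R) -
    \int[conv_iter_prob x k]_y (h y : R))) telescope_sumr//.
have u01 k : 0 <= \int[conv_iter_prob x k]_y (h y : R) <= 1.
  by apply: unit_Rintegral; [exact: unit_continuous_measurable|exact: uh.2].
rewrite normrM ger0_norm// ler_piMr//.
move: (u01 n.+1) (u01 0%N) => /andP[? ?] /andP[? ?].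
by rewrite ler_norml; apply/andP; split; lra.
Qed.

End cesaro_prob.

End convolution.

(** * Uniform equidistribution for unit test functions *)

Section main.
Context (R : realType) (G X : ptopologicalType) (act : G -> X -> X).
Variables (mX : probability (borel X) R) (mu : probability (borel G) R).
Hypothesis metG : metrizable_space R G.
Hypothesis scG : sigma_compact_space G.
Hypothesis metX : metrizable_space R X.
Hypothesis cact : continuous (fun p : G * X => act p.1 p.2).
Hypothesis ue : uniquely_ergodic act mu mX.
Hypothesis rec : lura act mu.

Local Notation P := (cesaro_prob mu metG scG cact).

Lemma unit_continuous_equidistribution (K : set X) (h : X -> R) (eps : R) :
  compact K -> unit_continuous h -> 0 < eps ->
  exists n0, forall n x, (n0 <= n)%N -> K x ->
    `| \int[P n x]_y (h y : R) - \int[mX]_y (h y : R) | < eps.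
Proof.
move=> cK uh eps0; apply: contrapT => /forallNP bad.
(* Failure for every threshold yields a sequence of bad pairs (time, starting point) whose times
   tend to infinity. *)
have /choice[s sP] n0 : exists p : nat * X, [/\ (n0 <= p.1)%N, K p.2 &
    eps <= `| \int[P p.1 p.2]_y (h y : R) - \int[mX]_y (h y : R) |].
  apply: contrapT => /forallNP nbad; apply: (bad n0) => n x n0n Kx.
  by rewrite ltNge; apply/negP => le; apply: (nbad (n, x)).
(* Since [F] refines the filter at infinity, whatever holds for all large [j] holds along [F]. *)
have [F [FU ooF]] := ultraFilterLemma (@eventually_filter).
pose Q j := P (s j).1 (s j).2.
have tight (e : R) : 0 < e ->
    exists M : set X, compact M /\ \forall j \near F, ((1 - e)%:E <= Q j M)%E.
  move=> e0; have [n0 [M [cM MP]]] := rec cK e0.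
  exists M; split => //; apply: ooF; exists n0 => // j /= n0j.
  (* Recurrence gives one compact [M] for all starting points of [K], so it does not matter that the
     point varies with [j]. *)
  have [js Ks _] := sP j; rewrite /Q cesaro_probE; apply: MP => //.
  by rewrite (leq_trans n0j)// (leq_trans js).
pose nu := @prokhorov_limit R X F FU metX Q tight.
have nuP g : unit_continuous g ->
    \int[Q j]_(x in setT) (g x : R) @[j --> F] --> \int[nu]_x (g x : R).
  exact: prokhorov_limit_cvg.
have nu_stationary : stationary act mu nu.
  apply: (@unit_continuous_measure_unique R X (conv_prob mu metG scG cact nu) nu metX).
  move=> g ug; rewrite Rintegral_conv_prob//.
  have uTg := unit_continuous_markov mu metX cact ug.
  apply/eqP; rewrite -subr_eq0; apply/eqP.
  (* The Feller property makes [markov_op act mu g] a test function too, so both integrals converge;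
     their difference is bounded by the inverse of the time and must vanish in the limit. *)
  have cvgT : \int[Q j]_x markov_op act mu g x - \int[Q j]_(x in setT) (g x : R)
      @[j --> F] --> \int[nu]_x markov_op act mu g x - \int[nu]_x (g x : R).
    by apply: cvgB; exact: nuP.
  rewrite -(cvg_lim (@Rhausdorff R) cvgT); apply: cvg_lim => //.
  apply/cvgrPdist_lt => e e0; apply: ooF.
  have [N _ NP] := near_infty_natSinv_lt (PosNum e0).
  exists N => // j /= Nj; rewrite sub0r normrN.
  apply: le_lt_trans (cesaro_prob_markov mu metG scG metX cact _ _ ug) _.
  have [js _ _] := sP j; apply: NP => /=.
  exact: leq_trans js.
have nuE : \int[nu]_x (h x : R) = \int[mX]_x (h x : R).
  congr fine; apply: eq_measure_integral => A mA _; exact: ue.2.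
have /cvgrPdist_lt/(_ _ eps0) := nuP h uh.
(* Convergence to the integral against [mX] brings some [j] within [eps], against the choice of
   [s]. *)
rewrite nuE => /filter_ex [j].
by rewrite distrC ltNge; have [_ _ ->] := sP j.
Qed.

End main.

(** * From unit test functions to compactly supported ones *)

Lemma compactly_supported_bounded (R : realType) (X : topologicalType)
    (f : X -> R) : compactly_supported_continuous f ->
  exists2 B, 0 < B & forall x, `|f x| <= B.
Proof.
case=> cf cS.
have : compact (f @` closure [set x | f x != 0]).
  by apply: continuous_compact => //; exact: continuous_subspaceT.
move=> /compact_bounded [B [_ Bf]].
have B1 : B < `|B| + 1 by rewrite ltr_pwDr// ler_norm.
exists (`|B| + 1); first by rewrite ltr_wpDl.
move=> x; have [->|fx0] := eqVneq (f x) 0; first by rewrite normr0 addr_ge0.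
by apply: (Bf _ B1); exists x => //; exact: subset_closure.
Qed.

Unset Implicit Arguments.

Theorem theorem4p4 (R : realType) (G X : ptopologicalType)
  (mul : G -> G -> G) (inv : G -> G) (one : G) (act : G -> X -> X)
  (mX : probability (borel X) R) (mu : probability (borel G) R) :
  lcsc_metrizable_group R mul inv one ->
  [/\ locally_compact_space X, sigma_compact_space X & metrizable_space R X] ->
  continuous_action mul one act ->
  invariant_measure act mX ->
  ergodic_action act mX ->
  uniquely_ergodic act mu mX ->
  lura act mu ->
  forall f : X -> R, compactly_supported_continuous f ->
  forall K : set X, compact K ->
  forall eps : R, 0 < eps ->
  exists n0 : nat, forall (n : nat) (x : X), (n0 <= n)%N -> K x ->
    (`| (n%:R^-1)%:E *
          \sum_(k < n) \int[conv_iter act mu k x]_(y in setT) (f y)%:E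
        - \int[mX]_(y in setT) (f y)%:E | < eps%:E)%E.
Proof.
move=> [_ _ _ _ [_ scG metG]] [_ _ metX] [_ _ cact] _ _ ue rec f ccf K cK eps eps0.
have [B B0 fB] := compactly_supported_bounded ccf.
have cf := ccf.1.
(* An affine change maps the range of [f], contained in the segment from [-B] to [B], into the unit
   interval; the tolerance is divided by the same [B *+ 2]. *)
pose h x := (f x + B) / (B *+ 2).
have B20 : 0 < B *+ 2 by rewrite pmulrn_lgt0.
have uh : unit_continuous h.
  split=> x.
    by apply: cvgM; [apply: cvgD; [exact: cf|exact: cvg_cst]|exact: cvg_cst].
  have := fB x; rewrite ler_norml => /andP[fB1 fB2].
  rewrite divr_ge0 ?(ltW B20)//=; last by rewrite -lerBlDr sub0r.
  by rewrite ler_pdivrMr// mul1r mulr2n lerD2r.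
have e20 : 0 < eps / (B *+ 2) by rewrite divr_gt0.
have [n0 n0P] := unit_continuous_equidistribution metG scG metX cact ue rec cK uh e20.
(* The shift rules out the empty average and matches [cesaro_prob] at [n], which has [n.+1]
   terms. *)
exists n0.+1 => -[//|n] x n0n Kx.
have mf : measurable_fun [set: borel X] (f : X -> R) by exact: continuous_borel.
have mh := unit_continuous_measurable uh.
(* Undoes the affine change inside extended-real integrals; boundedness of [f] makes them finite, so
   the rest is real arithmetic. *)
have fE (Q : probability (borel X) R) :
    (\int[Q]_(y in setT) (f y)%:E = (B *+ 2 * \int[Q]_y (h y : R) - B)%:E)%E.
  rewrite -[X in (_ - X)%R](Rintegral_probability_cst Q).
  rewrite -RintegralZl//; last exact: unit_integrable mh uh.2.
  rewrite -RintegralB//; last 2 first.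
  - have := integrableZl measurableT (B *+ 2) (unit_integrable Q mh uh.2); exact.
  - exact: finite_measure_integrable_cst.
  rewrite /Rintegral fineK.
    apply: eq_integral => y _; congr EFin.
    by rewrite /h mulrC divfK ?lt0r_neq0// addrK.
  apply: integrable_fin_num => //.
  rewrite (_ : (fun y => _) = EFin \o f).
    apply: measurable_bounded_integrable => //.
      by rewrite -ge0_fin_numE// fin_num_measure.
    exists B; split; first exact: num_real.
    by move=> b Bb y _ /=; exact: le_trans (fB y) (ltW Bb).
  by apply/funext => y /=; rewrite /h mulrC divfK ?lt0r_neq0// addrK.
rewrite (eq_bigr (fun k : 'I_n.+1 => (B *+ 2 *
    \int[conv_iter_prob mu metG scG cact x k]_y (h y : R) - B)%:E)); last first.
  by move=> k _; rewrite -(conv_iter_probE mu metG scG cact x k) fE.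
rewrite fE sumEFin -EFinM -EFinB /= lte_fin.
have := n0P n x n0n Kx; rewrite Rintegral_cesaro_prob//.
(* The constant [B] is subtracted in each of the [n.+1] terms, so it averages to [B] and cancels
   with the one from [mX]. *)
rewrite sumrB sumr_const card_ord -mulr_sumr.
set S := \sum_(k < n.+1) _; set I := \int[mX]_y _.
rewrite ltr_pdivlMr// -{1}(gtr0_norm B20) -normrM.
congr (`|_| < _).
by rewrite -mulr_natl; field; rewrite nat1r pnatr_eq0.
Qed.
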